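(* Let $\sigma$ be a finite relational vocabulary and $d\in\omega$. Let $\mathfrak{F}_\sigma^d$ be the class of finite $\sigma$-structures whose Gaifman graph has maximum degree at most $d$. If $\mathfrak{J}\subseteq\mathfrak{F}_\sigma^d$ is an $\mathbb{O}$-invariant elementary Boolean query on $\mathfrak{F}_\sigma^d$, then $\mathfrak{J}$ is first-order definable on $\mathfrak{F}_\sigma^d$, i.e. there is a first-order $\sigma$-sentence $\psi$ such that for every $\mathcal{A}\in\mathfrak{F}_\sigma^d$, $\mathcal{A}\in\mathfrak{J}$ if and only if $\mathcal{A}\models\psi$.
   Context: Gaifman graph $\mathcal{G}(\mathcal{A})$ of a $\sigma$-structure $\mathcal{A}$: vertices are the elements of $\mathcal{A}$; distinct $a,a'$ are adjacent iff there is $R\in\sigma$ and a tuple $\vec v$ with $R(\vec v)$ true in $\mathcal{A}$ such that both $a$ and $a'$ occur in $\vec v$. The neighbors of $a$ are the vertices adjacent to $a$. A local order on $\mathcal{A}$ is a ternary relation $\preceq$ on the domain such that $\preceq(a,b,c)$ implies $b,c$ are neighbors of $a$, and for each fixed $a$ the binary relation $\{(b,c):\preceq(a,b,c)\}$ is a linear order on the set of neighbors of $a$. $\mathbb{O}$ denotes the class of expansions $(\mathcal{A},\preceq)$ with $\preceq$ a local order on $\mathcal{A}$. For a class $\mathfrak{K}$ of $\sigma$-structures, a first-order sentence $\varphi$ in the vocabulary $\sigma\cup\{\preceq\}$ is $\mathbb{O}$-invariant on $\mathfrak{K}$ if for every $\mathcal{A}\in\mathfrak{K}$, either every local-order expansion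 $(\mathcal{A},\preceq)$ satisfies $\varphi$ or none does. A Boolean query $\mathfrak{J}\subseteq\mathfrak{K}$ is $\mathbb{O}$-invariant elementary on $\mathfrak{K}$ if there is such an $\mathbb{O}$-invariant sentence $\varphi$ with: for all $\mathcal{A}\in\mathfrak{K}$, $\mathcal{A}\in\mathfrak{J}$ iff some (equivalently every) local-order expansion of $\mathcal{A}$ satisfies $\varphi$. *)

(* Defs.v *)
From mathcomp Require Import all_boot.

Set Implicit Arguments.
Unset Strict Implicit.
Unset Printing Implicit Defensive.

Record vocabulary := Vocabulary { symbol : finType; arity : symbol -> nat }.

(* The empty structure is not excluded. *)
Record fin_structure (sigma : vocabulary) := FinStructure {
  dom :> finType;
  interp : forall s : symbol sigma, (arity s).-tuple dom -> bool
}.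

(* First-order formulas with equality, with free variables indexed by 'I_n.
   Variables are de Bruijn indices: variable 0 of the body of [fo_all] is the
   bound one.  The other connectives and [exists] are definable classically. *)
Inductive formula (sigma : vocabulary) : nat -> Type :=
| fo_false n : formula sigma n
| fo_eq n (i j : 'I_n) : formula sigma n
| fo_rel n (s : symbol sigma) (t : (arity s).-tuple 'I_n) : formula sigma n
| fo_imp n (f g : formula sigma n) : formula sigma n
| fo_all n (f : formula sigma n.+1) : formula sigma n.

Definition sentence (sigma : vocabulary) := formula sigma 0.

Fixpoint sat (sigma : vocabulary) (A : fin_structure sigma) (n : nat)
    (f : formula sigma n) : n.-tuple A -> bool :=
  match f in formula _ n return n.-tuple A -> bool with
  | fo_false _ => fun=> false
  | fo_eq _ i j => fun v => tnth v i == tnth v j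
  | fo_rel _ s t => fun v => interp [tuple of map (tnth v) t]
  | fo_imp _ f g => fun v => sat f v ==> sat g v
  | fo_all _ f => fun v => [forall x : A, sat f [tuple of x :: v]]
  end.

Definition models (sigma : vocabulary) (A : fin_structure sigma)
    (phi : sentence sigma) : bool := @sat sigma A 0 phi [tuple].

Section Gaifman.

Variables (sigma : vocabulary) (A : fin_structure sigma).

Definition gaifman : rel A := fun a b =>
  (a != b) && [exists s : symbol sigma, exists t : (arity s).-tuple A,
                 [&& interp t, a \in t & b \in t]].

Definition neighbors (a : A) : {set A} := [set b | gaifman a b].

Definition gaifman_max_degree : nat := \max_(a : A) #|neighbors a|.

Definition linear_order_on (D : {set A}) (r : rel A) : Prop :=
  [/\ {in D, reflexive r}, {in D &, antisymmetric r},
      {in D & &, transitive r} & {in D &, total r}].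

(* [lo a b c] reads: b precedes or equals c in the order attached to a. *)
Definition local_order (lo : A -> rel A) : Prop :=
  (forall a b c, lo a b c -> b \in neighbors a /\ c \in neighbors a) /\
  (forall a, linear_order_on (neighbors a) (lo a)).

End Gaifman.

(* The vocabulary with one additional ternary symbol, [None]. *)
Definition lo_arity (sigma : vocabulary) (o : option (symbol sigma)) : nat :=
  if o is Some s then arity s else 3.

Definition lo_vocabulary (sigma : vocabulary) : vocabulary :=
  Vocabulary (@lo_arity sigma).

Definition lo_interp (sigma : vocabulary) (A : fin_structure sigma)
    (lo : A -> rel A) (o : option (symbol sigma)) :
    (lo_arity o).-tuple A -> bool :=
  match o return (lo_arity o).-tuple A -> bool with
  | Some s => @interp sigma A s
  | None => fun t : 3.-tuple A =>
      lo (tnth t (inord 0)) (tnth t (inord 1)) (tnth t (inord 2))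
  end.

Definition expansion (sigma : vocabulary) (A : fin_structure sigma)
    (lo : A -> rel A) : fin_structure (lo_vocabulary sigma) :=
  @FinStructure (lo_vocabulary sigma) (dom A) (lo_interp lo).

Definition struct_class (sigma : vocabulary) := fin_structure sigma -> Prop.

Definition bounded_degree (sigma : vocabulary) (d : nat) : struct_class sigma :=
  fun A => gaifman_max_degree A <= d.

Definition O_invariant (sigma : vocabulary) (K : struct_class sigma)
    (phi : sentence (lo_vocabulary sigma)) : Prop :=
  forall A, K A ->
    (forall lo, @local_order sigma A lo -> models (expansion lo) phi) \/
    (forall lo, @local_order sigma A lo -> ~~ models (expansion lo) phi).

Definition O_invariant_elementary (sigma : vocabulary)
    (K J : struct_class sigma) : Prop :=
  exists2 phi : sentence (lo_vocabulary sigma), O_invariant K phi &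
    forall A, K A ->
      (J A <-> exists2 lo, @local_order sigma A lo & models (expansion lo) phi).

Definition fo_definable (sigma : vocabulary) (K J : struct_class sigma) : Prop :=
  exists psi : sentence sigma, forall A, K A -> (J A <-> models A psi).

(* Main.v *)
(* Let m be the rank of the order-invariant sentence. It suffices to find k
   such that any two structures A, B of degree at most d with the same rank-k
   type have local orders making their expansions equivalent up to rank m. Call
   the isomorphism type of an ordered ball of radius r a code, and say that an
   element admits a code if some local order makes its ball realize it. There
   are finitely many codes, so by pigeonhole some threshold t separates those
   admitted by at most t elements (rare) from those admitted by a number of
   elements huge with respect to t. For k large, the set S of elements
   admitting a rare code has isomorphic neighbourhoods in A and B. As the
   orders at distinct elements are independent, one can choose local orders on
   A and B which correspond under this isomorphism near S and under which every
   code that is not rare is realized many times far from S. Duplicator then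
   wins the m-round game as in Hanf's theorem, S being treated as a set of
   constants: a move close to earlier pebbles or S is answered by the current
   local isomorphism, and a move far from them by a fresh copy of its code,
   with no need to compare numbers of occurrences. *)

Require Import Defs.
From mathcomp Require Import all_boot.
From mathcomp Require Import boolp.

Set Implicit Arguments.
Unset Strict Implicit.
Unset Printing Implicit Defensive.

(** * Rank-k types, Hintikka formulas and back-and-forth *)

Section Formulas.

Variable sigma : vocabulary.
Implicit Types A B C : fin_structure sigma.

Definition fo_not n (f : formula sigma n) := fo_imp f (fo_false sigma n).
Definition fo_and n (f g : formula sigma n) := fo_not (fo_imp f (fo_not g)).
Definition fo_ex n (f : formula sigma n.+1) := fo_not (fo_all (fo_not f)).
Definition fo_conj n (s : seq (formula sigma n)) :=
  foldr (@fo_and n) (fo_not (fo_false sigma n)) s.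

Lemma sat_not A n (f : formula sigma n) (v : n.-tuple A) :
  sat (fo_not f) v = ~~ sat f v.
Proof. by rewrite /fo_not /= implybF. Qed.

Lemma sat_and A n (f g : formula sigma n) (v : n.-tuple A) :
  sat (fo_and f g) v = sat f v && sat g v.
Proof. by rewrite /= !implybF negb_imply negbK. Qed.

Lemma sat_ex A n (f : formula sigma n.+1) (v : n.-tuple A) :
  sat (fo_ex f) v = [exists x : A, sat f [tuple of x :: v]].
Proof.
rewrite /= implybF negb_forall; apply: eq_existsb => x.
by rewrite implybF negbK.
Qed.

Lemma sat_conj A n (s : seq (formula sigma n)) (v : n.-tuple A) :
  sat (fo_conj s) v = all (fun f => sat f v) s.
Proof. by elim: s => // f s IH; rewrite [fo_conj _]/= sat_and IH. Qed.

Fixpoint rank n (f : formula sigma n) : nat :=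
  match f with
  | fo_imp _ f g => maxn (rank f) (rank g)
  | fo_all _ f => (rank f).+1
  | _ => 0
  end.

Definition atom n : finType :=
  ('I_n * 'I_n + {s : symbol sigma & (arity s).-tuple 'I_n})%type.

Definition atom_formula n (a : atom n) : formula sigma n :=
  match a with
  | inl p => fo_eq sigma p.1 p.2
  | inr (existT s t) => fo_rel t
  end.

Definition atype n : finType := {ffun atom n -> bool}.

Definition atp A n (v : n.-tuple A) : atype n :=
  [ffun a => sat (atom_formula a) v].

(** Rank-[k] types are encoded as elements of a finite type, so that Hintikka formulas are finite
    conjunctions over an enumeration. Equality of types plays the role of Ehrenfeucht-Fraïssé
    equivalence, also between different structures. *)
Fixpoint ftype k n : finType :=
  if k is k'.+1 then (atype n * {set ftype k' n.+1})%type : finType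
  else atype n.

Fixpoint tp A k n : n.-tuple A -> ftype k n :=
  match k with
  | 0 => fun v => atp v
  | k'.+1 => fun v => (atp v, [set @tp A k' n.+1 [tuple of x :: v] | x : A])
  end.

Definition hintikka0 n (t : atype n) : formula sigma n :=
  fo_conj [seq if t a then atom_formula a else fo_not (atom_formula a)
          | a <- enum (atom n)].

Fixpoint hintikka k n : ftype k n -> formula sigma n :=
  match k with
  | 0 => @hintikka0 n
  | k'.+1 => fun t =>
      fo_and (hintikka0 t.1)
        (fo_conj [seq if u \in t.2 then fo_ex (hintikka u)
                      else fo_not (fo_ex (hintikka u))
                 | u <- enum (ftype k' n.+1)])
  end.

Lemma sat_hintikka0 A n (t : atype n) (v : n.-tuple A) :
  sat (hintikka0 t) v = (atp v == t).
Proof.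
rewrite sat_conj all_map; apply/allP/eqP => [H|<- a _ /=].
  apply/ffunP => a; have := H a (mem_enum _ a); rewrite ffunE /=.
  by case: (t a) => [//|]; rewrite sat_not => /negbTE.
by rewrite ffunE; case: ifP => // Ha; rewrite sat_not Ha.
Qed.

Lemma sat_hintikka A k n (t : ftype k n) (v : n.-tuple A) :
  sat (hintikka t) v = (tp k v == t).
Proof.
elim: k n t v => [|k IH] n t v; first exact: sat_hintikka0.
have ex_in u : sat (fo_ex (hintikka u)) v = (u \in (tp k.+1 v).2).
  rewrite sat_ex; apply/existsP/imsetP => [[x]|[x _ ->]].
    by rewrite IH => /eqP <-; exists x.
  by exists x; rewrite IH.
rewrite [hintikka _]/= sat_and sat_hintikka0 sat_conj all_map.
case: t => t U; rewrite -pair_eqE /pair_eq; congr (_ && _).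
(* The conjunct for [u] holds exactly when [u] lies in both sets or in neither. *)
rewrite (eq_all (a2 := fun u => (u \in U) == (u \in (tp k.+1 v).2))); last first.
  move=> u; transitivity (sat (if u \in U then fo_ex (hintikka u)
                               else fo_not (fo_ex (hintikka u))) v) => //.
  by case: (u \in U); last rewrite sat_not; rewrite ex_in; case: (u \in _).
apply/allP/eqP => [H|-> //]; apply/setP => u.
by rewrite [u \in U](eqP (H u (mem_enum _ u))).
Qed.

Lemma tpS_atp A B k n (v : n.-tuple A) (w : n.-tuple B) :
  tp k v = tp k w -> atp v = atp w.
Proof. by case: k => [|k] // [->]. Qed.

Lemma tpS_forth A B k n (v : n.-tuple A) (w : n.-tuple B) :
  tp k.+1 v = tp k.+1 w ->
  forall x : A, exists y : B, tp k [tuple of x :: v] = tp k [tuple of y :: w].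
Proof.
case=> _ E x; have : tp k [tuple of x :: v] \in (tp k.+1 v).2.
  exact: imset_f.
by rewrite /= E => /imsetP[y _ ->]; exists y.
Qed.

Lemma tpS_back A B k n (v : n.-tuple A) (w : n.-tuple B) :
  tp k.+1 v = tp k.+1 w ->
  forall y : B, exists x : A, tp k [tuple of x :: v] = tp k [tuple of y :: w].
Proof. by move=> E y; have [x Ex] := tpS_forth (esym E) y; exists x. Qed.

Lemma tpS_intro A B k n (v : n.-tuple A) (w : n.-tuple B) :
  atp v = atp w ->
  (forall x : A, exists y : B,
      tp k [tuple of x :: v] = tp k [tuple of y :: w]) ->
  (forall y : B, exists x : A,
      tp k [tuple of x :: v] = tp k [tuple of y :: w]) ->
  tp k.+1 v = tp k.+1 w.
Proof.
move=> E F G /=; rewrite E; congr pair; apply/setP => u.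
apply/imsetP/imsetP => [[x _ ->]|[y _ ->]].
  by have [y ->] := F x; exists y.
by have [x <-] := G y; exists x.
Qed.

Lemma tp_le A B k l n (v : n.-tuple A) (w : n.-tuple B) :
  k <= l -> tp l v = tp l w -> tp k v = tp k w.
Proof.
elim: k l n v w => [|k IH] [|l] n v w // le_kl E.
- exact: (tpS_atp E).
- apply: tpS_intro (tpS_atp E) _ _ => [x|y].
    by have [y] := tpS_forth E x; exists y; apply: IH le_kl _.
  by have [x] := tpS_back E y; exists x; apply: IH le_kl _.
Qed.

(** Spoiler plays [m] rounds in a row on the same side; each costs one unit of rank. *)
Lemma tp_forth A B k m n (v : n.-tuple A) (w : n.-tuple B) :
  tp (m + k) v = tp (m + k) w ->
  forall s : m.-tuple A, exists s' : m.-tuple B,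
    tp k [tuple of s ++ v] = tp k [tuple of s' ++ w].
Proof.
elim: m k => [|m IH] k E s.
  exists [tuple]; rewrite tuple0.
  have Ecat C (u : n.-tuple C) : [tuple of [tuple] ++ u] = u by apply: val_inj.
  by rewrite !Ecat.
rewrite addSnnS in E; case/tupleP: s => x s.
have [s' /tpS_forth/(_ x)[y Ey]] := IH _ E s.
exists [tuple of y :: s'].
have Ecat C z (p : m.-tuple C) (u : n.-tuple C) :
    [tuple of [tuple of z :: p] ++ u] = [tuple of z :: [tuple of p ++ u]].
  exact: val_inj.
by rewrite !Ecat.
Qed.

Lemma atp_sat A B n (v : n.-tuple A) (w : n.-tuple B) :
  atp v = atp w -> forall a : atom n,
  sat (atom_formula a) v = sat (atom_formula a) w.
Proof. by move=> /ffunP E a; have := E a; rewrite !ffunE. Qed.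

Lemma atp_eq A B n (v : n.-tuple A) (w : n.-tuple B) :
  atp v = atp w -> forall i j,
  (tnth v i == tnth v j) = (tnth w i == tnth w j).
Proof. by move=> E i j; exact: (atp_sat E (inl (i, j))). Qed.

Lemma atp_rel A B n (v : n.-tuple A) (w : n.-tuple B) :
  atp v = atp w -> forall s (t : (arity s).-tuple 'I_n),
  interp [tuple of map (tnth v) t] = interp [tuple of map (tnth w) t].
Proof. by move=> E s t; exact: (atp_sat E (inr (existT _ s t))). Qed.

Lemma sat_tp A B k n (f : formula sigma n) (v : n.-tuple A) (w : n.-tuple B) :
  rank f <= k -> tp k v = tp k w -> sat f v = sat f w.
Proof.
elim: f k v w => {n} [n|n i j|n s t|n f IHf g IHg|n f IHf] k v w //.
- by move=> _ /tpS_atp/atp_eq E; apply: E.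
- by move=> _ /tpS_atp/atp_rel E; apply: E.
- by rewrite geq_max => /andP[lef leg] E; congr (_ ==> _); [apply: IHf E|apply: IHg E].
- case: k => // k le E /=; apply/forallP/forallP => H.
    move=> y; have [x Ex] := tpS_back E y.
    by rewrite -(IHf k _ _ le Ex).
  by move=> x; have [y Ey] := tpS_forth E x; rewrite (IHf k _ _ le Ey).
Qed.

(** There are finitely many rank-[k] types, so the disjunction of the Hintikka sentences of those
    realized in [J], written here with negations, defines [J]. These types are selected
    classically. *)
Lemma fo_definable_of_tp (K J : struct_class sigma) k :
  (forall A B, K A -> K B -> tp k [tuple of [::] : seq A] =
     tp k [tuple of [::] : seq B] -> J A -> J B) ->
  fo_definable K J.
Proof.
move=> HJ.
pose good (t : ftype k 0) := `[< exists2 A, K A & J A /\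
  tp k [tuple of [::] : seq A] = t >].
exists (fo_not (fo_conj [seq fo_not (hintikka t) | t <- enum good])) => A KA.
rewrite /models sat_not sat_conj all_map.
rewrite (eq_all (a2 := predC (pred1 (tp k [tuple of [::] : seq A])))); last first.
  move=> t; transitivity (sat (fo_not (hintikka t)) [tuple of [::] : seq A]) => //.
  by rewrite sat_not sat_hintikka eq_sym.
rewrite -has_predC; split=> [JA|/hasP[t]].
  apply/hasP; exists (tp k [tuple of [::] : seq A]); last by rewrite /= eqxx.
  by rewrite mem_enum; apply/asboolP; exists A.
rewrite mem_enum /= negbK => /asboolP[B KB [JB tB]] /eqP tA.
by apply: HJ JB => //; rewrite tB.
Qed.

End Formulas.

(** * Gaifman balls and their size *)

Section Balls.

Variables (sigma : vocabulary) (A : fin_structure sigma).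
Implicit Types (P Q : {set A}) (x y : A).

Lemma gaifman_sym : symmetric (@gaifman sigma A).
Proof.
move=> x y; rewrite /gaifman eq_sym; congr (_ && _).
apply: eq_existsb => s; apply: eq_existsb => t.
by rewrite [(x \in t) && _]andbC.
Qed.

Fixpoint ball r P : {set A} :=
  if r is r'.+1 then ball r' P :|: \bigcup_(x in ball r' P) neighbors x else P.

Lemma ballSP r P y :
  reflect (y \in ball r P \/ exists2 x, x \in ball r P & gaifman x y)
          (y \in ball r.+1 P).
Proof.
rewrite [ball _ _]/= inE; apply: (iffP orP) => [[|/bigcupP[x Px]]|[|[x Px xy]]].
- by left.
- by rewrite inE => xy; right; exists x.
- by left.
- by right; apply/bigcupP; exists x; rewrite ?inE.
Qed.

Lemma ball_mono r s P Q : r <= s -> P \subset Q -> ball r P \subset ball s Q.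
Proof.
move=> /subnK <- sPQ; elim: (s - r) => [|k IH]; last first.
  by rewrite addSn (subset_trans IH) //= subsetUl.
elim: r => [|r IH] //; apply/subsetP => y /ballSP[Py|[x Px xy]]; apply/ballSP.
  by left; apply: (subsetP IH).
by right; exists x => //; apply: (subsetP IH).
Qed.

Lemma ballW r s P : r <= s -> {subset ball r P <= ball s P}.
Proof. by move=> le_rs; apply/subsetP/ball_mono. Qed.

Lemma ball_neighbor r P x y : x \in ball r P -> gaifman x y -> y \in ball r.+1 P.
Proof. by move=> Px xy; apply/ballSP; right; exists x. Qed.

Lemma ball_id r P : P \subset ball r P.
Proof. exact: (@ball_mono 0). Qed.

Lemma ball_center r x : x \in ball r [set x].
Proof. by apply: (subsetP (ball_id r _)); rewrite inE. Qed.

Lemma ballU r P Q : ball r (P :|: Q) = ball r P :|: ball r Q.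
Proof.
by elim: r => //= r ->; rewrite bigcup_setU setUACA.
Qed.

Lemma ball_ball r s P : ball r (ball s P) = ball (r + s) P.
Proof. by elim: r => //= r ->. Qed.

(** Triangle inequality through the common point [y]. *)
Lemma ball_back r s P x y :
  y \in ball r [set x] -> y \in ball s P -> x \in ball (r + s) P.
Proof.
elim: r s y => [|r IH] s y; first by rewrite inE => /eqP->.
case/ballSP => [yx Py|[z zx zy] Py]; first exact: ballW (IH _ _ yx Py).
rewrite addSnnS; apply: IH zx _.
by apply: ball_neighbor Py _; rewrite gaifman_sym.
Qed.

Lemma ball_point r P x :
  x \in ball r P -> exists2 p, p \in P & x \in ball r [set p].
Proof.
elim: r x => [|r IH] x; first by move=> Px; exists x; rewrite // inE.
case/ballSP => [/IH[p Pp xp]|[y /IH[p Pp yp] yx]]; exists p => //.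
  exact: ballW xp.
exact: ball_neighbor yp yx.
Qed.

Lemma card_bigcup_le (I : finType) (P : {set I}) (F : I -> {set A}) m :
  (forall i, i \in P -> #|F i| <= m) -> #|\bigcup_(i in P) F i| <= #|P| * m.
Proof.
move=> leF; rewrite -sum_nat_const.
elim/big_rec2: _ => [|i n U Pi leU]; first by rewrite cards0.
rewrite (leq_trans (leq_card_setU _ _)) // leq_add //; exact: leF.
Qed.

Lemma card_ball d r P : bounded_degree d A -> #|ball r P| <= #|P| * d.+1 ^ r.
Proof.
move=> dA; elim: r => [|r IH]; first by rewrite muln1.
rewrite (leq_trans (leq_card_setU _ _)) //.
rewrite expnS mulnCA mulSn leq_add //.
apply: (@leq_trans (#|ball r P| * d)); last by rewrite mulnC leq_mul2l IH orbT.
apply: card_bigcup_le => x _; apply: leq_trans dA.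
exact: (leq_bigmax (F := fun x : A => #|neighbors x|)).
Qed.

End Balls.

(** * Isomorphisms between neighbourhoods *)

Section LocalIso.

Variables (sigma : vocabulary) (A B : fin_structure sigma).
Implicit Types (P : {set A}) (f : A -> B).

(** Injectivity at radius [r.+1] separates the neighbours of points of the [r]-ball. Equality of
    neighbourhoods makes [f] map balls onto balls, with no mention of an inverse. *)
Definition local_iso r P f : Prop :=
  [/\ {in ball r.+1 P &, injective f},
      forall s (t : (arity s).-tuple A), {subset t <= ball r P} ->
        interp [tuple of map f t] = interp t
    & forall x, x \in ball r P -> f @: neighbors x = neighbors (f x)].

Definition local_order_iso r P f (loA : A -> rel A) (loB : B -> rel B) : Prop :=
  forall x y z, x \in ball r P -> y \in neighbors x -> z \in neighbors x ->
    loB (f x) (f y) (f z) = loA x y z.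

Lemma local_iso_sub r s P P' f : ball s P' \subset ball r P ->
  ball s.+1 P' \subset ball r.+1 P -> local_iso r P f -> local_iso s P' f.
Proof.
move=> /subsetP le1 /subsetP le2 [f_inj f_rel f_nbr]; split=> [x y Px Py|i t Pt|x Px].
- by apply: f_inj; apply: le2.
- by apply: f_rel => x /Pt/le1.
- exact/f_nbr/le1.
Qed.

Lemma local_order_iso_sub r s P P' f loA loB : ball s P' \subset ball r P ->
  local_order_iso r P f loA loB -> local_order_iso s P' f loA loB.
Proof. by move=> /subsetP le1 H x y z /le1; apply: H. Qed.

Lemma local_iso_ball r P f s : local_iso r P f -> s <= r.+1 ->
  f @: ball s P = ball s (f @: P).
Proof.
move=> [_ _ f_nbr]; elim: s => [//|s IH] lt_sr.
rewrite /= -IH ?(ltnW lt_sr) // imsetU; congr (_ :|: _).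
apply/setP => y; apply/imsetP/bigcupP.
  case=> z /bigcupP[x Px xz] ->; exists (f x); first exact: imset_f.
  by rewrite -f_nbr ?imset_f // (ballW _ Px).
case=> _ /imsetP[x Px ->]; rewrite -f_nbr ?(ballW _ Px) //.
by case/imsetP=> z xz ->; exists z => //; apply/bigcupP; exists x.
Qed.

(** Off the neighbours of the first argument both orders are false, and [f] matches neighbourhoods,
    so agreement on neighbours is enough. *)
Lemma local_iso_lo r P f loA loB x y z :
  local_iso r P f -> local_order_iso r P f loA loB ->
  local_order loA -> local_order loB ->
  x \in ball r P -> y \in ball r.+1 P -> z \in ball r.+1 P ->
  loB (f x) (f y) (f z) = loA x y z.
Proof.
move=> [f_inj _ f_nbr] f_lo [loA_nbr _] [loB_nbr _] Px Py Pz.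
have nbr_f u : u \in ball r.+1 P -> f u \in neighbors (f x) -> u \in neighbors x.
  move=> Pu; rewrite -f_nbr // => /imsetP[u' xu' /f_inj->//].
  by apply: ball_neighbor Px _; rewrite inE in xu'.
have [xy|/negP xy] := boolP (y \in neighbors x); last first.
  by apply/idP/idP => [/loB_nbr[/(nbr_f _ Py)]|/loA_nbr[]].
have [xz|/negP xz] := boolP (z \in neighbors x); last first.
  by apply/idP/idP => [/loB_nbr[_ /(nbr_f _ Pz)]|/loA_nbr[]].
exact: f_lo.
Qed.

(** Balls grow through covered points only, so matching adjacency matches balls by induction on the
    radius. Adjacency is a hypothesis of its own, because a tuple witnessing it may leave the
    enumerated points. *)
Lemma local_iso_enum (I : finType) (e : I -> A) (e' : I -> B) r P (Q : {set B}) f :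
  (forall i j, (e i == e j) = (e' i == e' j)) ->
  (forall s (t : (arity s).-tuple I),
     interp [tuple of map e t] = interp [tuple of map e' t]) ->
  (forall i j, gaifman (e i) (e j) = gaifman (e' i) (e' j)) ->
  (forall i, (e i \in P) = (e' i \in Q)) ->
  (forall x, x \in ball r.+1 P -> exists i, x = e i) ->
  (forall y, y \in ball r.+1 Q -> exists i, y = e' i) ->
  (forall i, f (e i) = e' i) ->
  [/\ forall i s, s <= r.+1 -> (e i \in ball s P) = (e' i \in ball s Q),
      local_iso r P f & f @: P = Q].
Proof.
move=> e_eq e_rel e_adj e_P coverA coverB fE.
have ballE i s : s <= r.+1 -> (e i \in ball s P) = (e' i \in ball s Q).
  elim: s i => [|s IH] i lt_sr; first exact: e_P.
  have le_sr := ltnW lt_sr.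
  apply/ballSP/ballSP; rewrite IH // => -[Pi|[x Px xi]]; first by left.
  - right; have [j ex] := coverA x (ballW le_sr Px).
    by exists (e' j); rewrite -?IH // -?ex // -e_adj -ex.
  - by left.
  - right; have [j ex] := coverB x (ballW le_sr Px).
    by exists (e j); rewrite ?IH // -?ex // e_adj -ex.
split=> //; first split.
- move=> x y /coverA[i ->] /coverA[j ->] /eqP.
  by rewrite !fE -e_eq => /eqP.
- move=> s t Pt; have /fin_all_exists[g gE] k : exists i, tnth t k = e i.
    by apply: coverA; apply: ballW (Pt _ (mem_tnth k t)).
  have -> : t = [tuple of map e [tuple g k | k < arity s]].
    by apply: eq_from_tnth => k; rewrite tnth_map tnth_mktuple gE.
  rewrite e_rel; congr (interp _); apply: eq_from_tnth => k.
  by rewrite !tnth_map fE.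
- move=> x Px; have [i ex] := coverA x (ballW (leqnSn r) Px); subst x.
  rewrite fE; apply/setP => y; rewrite inE; apply/imsetP/idP.
    case=> z; rewrite inE => iz ->.
    have [j ez] := coverA z (ball_neighbor Px iz); subst z.
    by rewrite fE -e_adj.
  move=> iy; rewrite ballE // in Px.
  have [j ey] := coverB y (ball_neighbor Px iy); subst y.
  by exists (e j); rewrite ?fE // inE e_adj.
- apply/setP => y; apply/imsetP/idP => [[x Px ->]|Qy].
    have [i ex] := coverA x (subsetP (ball_id _ _) x Px); subst x.
    by rewrite fE -e_P.
  have [i ey] := coverB y (subsetP (ball_id _ _) y Qy); subst y.
  by exists (e i); rewrite ?fE ?e_P.
Qed.

Lemma enum_fun (I : finType) (e : I -> A) (e' : I -> B) (f0 : A -> B) :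
  (forall i j, (e i == e j) = (e' i == e' j)) ->
  exists f, forall i, f (e i) = e' i.
Proof.
move=> e_eq; exists (fun x => if [pick i | e i == x] is Some i then e' i else f0 x).
move=> i; case: pickP => [j|/(_ i)]; last by rewrite eqxx.
by rewrite e_eq => /eqP.
Qed.

End LocalIso.

(** * Adjacency and balls are preserved by types *)

Section TypesAndBalls.

Variable sigma : vocabulary.
Implicit Types A B C D : fin_structure sigma.

Definition max_arity : nat := \max_(s : symbol sigma) arity s.

(** A tuple witnessing adjacency has at most [max_arity] entries and can be copied round by round;
    equality atoms locate the two elements in the copy. *)
Lemma tp_gaifman A B k n (v : n.-tuple A) (w : n.-tuple B) i j :
  max_arity <= k -> tp k v = tp k w ->
  gaifman (tnth v i) (tnth v j) = gaifman (tnth w i) (tnth w j).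
Proof.
have half C D (p : n.-tuple C) (q : n.-tuple D) : max_arity <= k ->
    tp k p = tp k q -> gaifman (tnth p i) (tnth p j) ->
    gaifman (tnth q i) (tnth q j).
  move=> le_k E /andP[ij /existsP[s /existsP[t /and3P[ts it jt]]]].
  rewrite /gaifman -(atp_eq (tpS_atp E)) ij; apply/existsP; exists s.
  have le_s : arity s + 0 <= k.
    by rewrite addn0; apply: leq_trans le_k; apply: (leq_bigmax (F := @arity sigma)).
  have [t' /tpS_atp E'] := tp_forth (tp_le le_s E) t.
  have in_t' a : tnth p a \in t -> tnth q a \in t'.
    case/tnthP=> b /eqP; rewrite -(tnth_rshift t) -(tnth_lshift t p).
    by rewrite (atp_eq E') tnth_lshift tnth_rshift => /eqP->; apply: mem_tnth.
  apply/existsP; exists t'; rewrite !in_t' // !andbT.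
  have := atp_rel E' [tuple lshift n b | b < arity s].
  set t1 := [tuple of _]; set t2 := [tuple of _].
  have -> : t1 = t.
    by apply: eq_from_tnth => b; rewrite tnth_map tnth_mktuple tnth_lshift.
  have -> : t2 = t'.
    by apply: eq_from_tnth => b; rewrite tnth_map tnth_mktuple tnth_lshift.
  by move=> <-.
by move=> le_k E; apply/idP/idP; apply: half.
Qed.

(** Each step of a path costs one round, and [max_arity] rounds remain to check adjacency. *)
Lemma tp_ball A B k n r (v : n.-tuple A) (w : n.-tuple B) i j :
  r + max_arity <= k -> tp k v = tp k w ->
  (tnth v i \in ball r [set tnth v j]) = (tnth w i \in ball r [set tnth w j]).
Proof.
have half C D m l (p : m.-tuple C) (q : m.-tuple D) a b : r + max_arity <= l ->
    tp l p = tp l q -> tnth p a \in ball r [set tnth p b] ->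
    tnth q a \in ball r [set tnth q b].
  elim: r l m p q a b => [|s IH] l m p q a b le_l E.
    by rewrite !inE (atp_eq (tpS_atp E)).
  case: l le_l E => // l le_l E.
  case/ballSP => [pa|[x xb xa]]; apply/ballSP.
    by left; apply: IH (tp_le (leqnSn l) E) pa.
  have [y Ey] := tpS_forth E x; right; exists y.
    have := IH l _ _ _ ord0 (lift ord0 b) le_l Ey.
    by rewrite !tnthS !tnth0; apply.
  have le_l' : max_arity <= l := leq_trans (leq_addl s _) le_l.
  have := tp_gaifman ord0 (lift ord0 a) le_l' Ey.
  by rewrite !tnthS !tnth0 xa => <-.
by move=> le_k E; apply/idP/idP; [apply: half le_k E|apply: half le_k (esym E)].
Qed.

End TypesAndBalls.

(** * Patching and transporting local orders *)

Section LocalOrders.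

Variable sigma : vocabulary.
Implicit Types A B C D : fin_structure sigma.

Lemma local_order_exists A : exists lo : A -> rel A, local_order lo.
Proof.
exists (fun a b c => [&& b \in neighbors a, c \in neighbors a &
                       enum_rank b <= enum_rank c]).
split=> [a b c /and3P[]//|a]; split=> [b ab|b c ab ac|c b e ac ab ae|b c ab ac].
- by rewrite ab leqnn.
- rewrite ab ac /= -eqn_leq => /eqP E; exact/enum_rank_inj/val_inj.
- by rewrite ab ac ae; apply: leq_trans.
- by rewrite ab ac leq_total.
Qed.

(** The orders at distinct elements are independent: this is what allows codes to be placed one at a
    time. *)
Lemma local_order_patch A (X : pred A) (lo lo' : A -> rel A) :
  local_order lo -> local_order lo' ->
  local_order (fun x => if X x then lo' x else lo x).
Proof.
move=> [n1 l1] [n2 l2]; split=> [a b c|a]; case: ifP => _.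
- exact: n2.
- exact: n1.
- exact: l2.
- exact: l1.
Qed.

(** [f] carries the neighbours of [x] bijectively onto those of [f x], so the order at [x] can be
    pushed forward. Points with no preimage in the ball get the arbitrary order [lo0]. *)
Lemma local_order_transport A B r P (f : A -> B) (lo : A -> rel A) :
  local_iso r P f -> local_order lo ->
  exists2 lo' : B -> rel B, local_order lo' & local_order_iso r P f lo lo'.
Proof.
move=> [f_inj _ f_nbr] [lo_nbr lo_lin].
have [lo0 [lo0_nbr lo0_lin]] := local_order_exists B.
pose lo' y u u' := if [pick x | x \in ball r P & f x == y] is Some x then
  [exists z in neighbors x, exists z' in neighbors x,
     [&& f z == u, f z' == u' & lo x z z']] else lo0 y u u'.
have nbr_ball x z : x \in ball r P -> z \in neighbors x -> z \in ball r.+1 P.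
  by move=> Px; rewrite inE; apply: ball_neighbor.
have lo'E : local_order_iso r P f lo lo'.
  move=> x z z' Px xz xz'; rewrite /lo'; case: pickP => [x1 /andP[Px1]|/(_ x)].
    move=> /eqP/f_inj->; rewrite ?(ballW _ Px) ?(ballW _ Px1) //.
    apply/exists_inP/idP => [[z1 xz1 /exists_inP[z1' xz1']]|xzz'].
      case/and3P=> /eqP/(f_inj _ _ (nbr_ball _ _ Px xz1) (nbr_ball _ _ Px xz))->.
      by move=> /eqP/(f_inj _ _ (nbr_ball _ _ Px xz1') (nbr_ball _ _ Px xz'))->.
    by exists z => //; apply/exists_inP; exists z'; rewrite ?eqxx.
  by rewrite Px eqxx.
exists lo' => //; split=> [y u u'|y].
  rewrite /lo'; case: pickP => [x /andP[Px /eqP<-]|_]; last exact: lo0_nbr.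
  case/exists_inP => z xz /exists_inP[z' xz' /and3P[/eqP<- /eqP<- _]].
  by rewrite -f_nbr // !imset_f.
case: (pickP [pred x | x \in ball r P & f x == y]) => [x /andP[Px /eqP<-]|no].
  have [l1 l2 l3 l4] := lo_lin x.
  split; rewrite -f_nbr //.
  - by move=> _ /imsetP[z xz ->]; rewrite lo'E ?l1.
  - by move=> _ _ /imsetP[z xz ->] /imsetP[z' xz' ->]; rewrite !lo'E // => /l2->.
  - move=> _ _ _ /imsetP[z xz ->] /imsetP[z' xz' ->] /imsetP[z2 xz2 ->].
    by rewrite !lo'E //; apply: l3.
  - by move=> _ _ /imsetP[z xz ->] /imsetP[z' xz' ->]; rewrite !lo'E ?l4.
have E : lo' y =2 lo0 y.
  by move=> u u'; rewrite /lo'; case: pickP => // x Hx; have := no x; rewrite /= Hx.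
have [l1 l2 l3 l4] := lo0_lin y; split=> [u yu|u u' yu yu'|u' u u2 yu' yu yu2|u u' yu yu'].
- by rewrite E l1.
- by rewrite !E; apply: l2.
- by rewrite !E; apply: l3.
- by rewrite !E; apply: l4.
Qed.

End LocalOrders.

(** * Codes of ordered balls *)

Section Codes.

Variables (sigma : vocabulary) (d r : nat).
Implicit Types A B C D : fin_structure sigma.

(** The bound of [card_ball] for a ball of radius [r.+1] around one point. *)
Definition code_size := d.+1 ^ r.+1.

(** The components describe an enumeration of a ball: atomic type, adjacency, position of the
    centre, order. An element may realize several codes, as its ball has several enumerations; what
    matters is finiteness and that a common code yields isomorphic ordered balls. *)
Definition code : finType :=
  (atype sigma code_size * {ffun 'I_code_size * 'I_code_size -> bool}
   * {ffun 'I_code_size -> bool}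
   * {ffun 'I_code_size * 'I_code_size * 'I_code_size -> bool})%type.

(* The order is recorded only at points of [ball r [set a]], so that patching
   it outside this ball does not change the code. *)
Definition code_of A (lo : A -> rel A) (a : A) (e : code_size.-tuple A) : code :=
  (atp e, [ffun p => gaifman (tnth e p.1) (tnth e p.2)],
   [ffun i => tnth e i == a],
   [ffun p => (tnth e p.1.1 \in ball r [set a]) &&
              lo (tnth e p.1.1) (tnth e p.1.2) (tnth e p.2)]).

(* The tuple only has to cover the ball: it may repeat elements or leave it. *)
Definition realizes A (lo : A -> rel A) (a : A) (o : code) : Prop :=
  exists2 e : code_size.-tuple A,
    forall x, x \in ball r.+1 [set a] -> exists i, x = tnth e i
  & code_of lo a e = o.

Lemma realizes_exists A (lo : A -> rel A) a :
  bounded_degree d A -> exists o, realizes lo a o.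
Proof.
move=> dA; pose e := [tuple nth a (enum (ball r.+1 [set a])) i | i < code_size].
exists (code_of lo a e), e => // x; rewrite -mem_enum => ax.
have lt_x : index x (enum (ball r.+1 [set a])) < code_size.
  rewrite (leq_trans (_ : _ < #|ball r.+1 [set a]|)) //.
    by rewrite cardE index_mem.
  by have := card_ball r.+1 [set a] dA; rewrite cards1 mul1n.
by exists (Ordinal lt_x); rewrite tnth_mktuple nth_index.
Qed.

Lemma realizes_iso A B loA loB (a : A) (b : B) o :
  realizes loA a o -> realizes loB b o ->
  exists f : A -> B, [/\ local_iso r [set a] f,
    local_order_iso r [set a] f loA loB & f a = b].
Proof.
move=> [e covA <-] [e' covB [E1 /ffunP E2 /ffunP E3 /ffunP E4]].
have e_eq i j : (tnth e i == tnth e j) = (tnth e' i == tnth e' j).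
  by rewrite (atp_eq E1).
have [f fE] := enum_fun (fun=> b) e_eq.
have e_adj i j : gaifman (tnth e i) (tnth e j) = gaifman (tnth e' i) (tnth e' j).
  by have := E2 (i, j); rewrite !ffunE.
have e_a i : (tnth e i == a) = (tnth e' i == b) by have := E3 i; rewrite !ffunE.
have [||inball fiso _] :=
  local_iso_enum e_eq _ e_adj _ covA covB fE.
- by move=> s t; rewrite (atp_rel E1).
- by move=> i; rewrite !inE e_a.
exists f; split=> // [x y z ax|].
  rewrite !inE => xy xz.
  have [i ex] := covA x (ballW (leqnSn r) ax); subst x.
  have [j ey] := covA y (ball_neighbor ax xy); subst y.
  have [k ez] := covA z (ball_neighbor ax xz); subst z.
  by have := E4 (i, j, k); rewrite !ffunE /= !fE -inball // ax.
have [i ea] := covA a (ball_center _ a).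
by rewrite {1}ea fE; apply/eqP; rewrite -e_a -ea.
Qed.

Lemma realizes_agree A (lo lo' : A -> rel A) a o :
  (forall x, x \in ball r [set a] -> lo x =2 lo' x) ->
  realizes lo a o -> realizes lo' a o.
Proof.
move=> H [e cov <-]; exists e => //; congr (_, _).
by apply/ffunP => p; rewrite !ffunE; case: (boolP (_ \in _)) => //= /H->.
Qed.

Definition code_set A (o : code) : {set A} :=
  [set a | `[< exists2 lo, local_order lo & realizes lo a o >]].

(** The quantifier over local orders costs no rank: [code_size] rounds copy the enumeration of the
    ball, and the order is then transported along the resulting local isomorphism. One more round
    and [tp_ball] show that the copy covers the ball. *)
Lemma tp_code_set A B k n (v : n.-tuple A) (w : n.-tuple B) i o :
  code_size + (r.+2 + max_arity sigma) <= k -> tp k v = tp k w ->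
  (tnth v i \in code_set A o) = (tnth w i \in code_set B o).
Proof.
have half C D (p : n.-tuple C) (q : n.-tuple D) :
    code_size + (r.+2 + max_arity sigma) <= k -> tp k p = tp k q ->
    tnth p i \in code_set C o -> tnth q i \in code_set D o.
  rewrite !inE => le_k E /asboolP[lo lo_lo [e cov <-]].
  have [e' E'] := tp_forth (tp_le le_k E) e; have E0 := tpS_atp E'.
  have e_eq a b : (tnth e a == tnth e b) = (tnth e' a == tnth e' b).
    by have := atp_eq E0 (lshift n a) (lshift n b); rewrite !tnth_lshift.
  have e_i a : (tnth e a == tnth p i) = (tnth e' a == tnth q i).
    have := atp_eq E0 (lshift n a) (rshift code_size i).
    by rewrite !tnth_lshift !tnth_rshift.
  have e_adj a b :
      gaifman (tnth e a) (tnth e b) = gaifman (tnth e' a) (tnth e' b).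
    have := tp_gaifman (lshift n a) (lshift n b) _ E'.
    by rewrite !tnth_lshift; apply; rewrite leq_addl.
  have [f fE] := enum_fun (fun=> tnth q i) e_eq.
  have e_atp : atp e = atp e'.
    apply/ffunP; case=> [[a b]|[s t]]; rewrite !ffunE /=; first exact: e_eq.
    have := atp_rel E0 [tuple of map (lshift n) t].
    set t1 := [tuple of _]; set t2 := [tuple of _].
    have -> : t1 = [tuple of map (tnth e) t].
      by apply: eq_from_tnth => b; rewrite !tnth_map tnth_lshift.
    have -> : t2 = [tuple of map (tnth e') t].
      by apply: eq_from_tnth => b; rewrite !tnth_map tnth_lshift.
    by [].
  (* The answer to [y] lies in the ball around [tnth p i], hence equals some entry of [e]; so [y]
     equals the matching entry of [e']. *)
  have cov' y : y \in ball r.+1 [set tnth q i] -> exists j, y = tnth e' j.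
    move=> qy; have [x Ex] : exists x, tp (r.+1 + max_arity sigma) [tuple of x :: _] = tp _ _ :=
      tpS_back E' y.
    have := tp_ball ord0 (lift ord0 (rshift code_size i)) (leqnn _) Ex.
    rewrite !tnthS !tnth0 !tnth_rshift qy => /cov[j ex].
    exists j; have := atp_eq (tpS_atp Ex) ord0 (lift ord0 (lshift n j)).
    by rewrite !tnthS !tnth0 !tnth_lshift ex eqxx => /esym/eqP.
  have [||inball fiso _] := local_iso_enum e_eq _ e_adj _ cov cov' fE.
  - by move=> s t; rewrite (atp_rel e_atp).
  - by move=> a; rewrite !inE e_i.
  have [lo' lo_lo' flo] := local_order_transport fiso lo_lo.
  apply/asboolP; exists lo' => //; exists e' => //.
  rewrite /code_of e_atp; congr (_, _, _, _); apply/ffunP.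
  - by case=> a b; rewrite !ffunE e_adj.
  - by move=> a; rewrite !ffunE e_i.
  case=> [[a b] c]; rewrite !ffunE /= -inball //.
  case: (boolP (_ \in _)) => //= pa.
  have [ab|ab] := boolP (tnth e b \in neighbors (tnth e a)); last first.
    apply/idP/idP => [/(proj1 lo_lo')[]|/(proj1 lo_lo)[]].
      by rewrite inE -e_adj => ba; rewrite inE ba in ab.
    by rewrite (negbTE ab).
  have [ac|ac] := boolP (tnth e c \in neighbors (tnth e a)); last first.
    apply/idP/idP => [/(proj1 lo_lo')[]|/(proj1 lo_lo)[]].
      by move=> _; rewrite inE -e_adj => ca; rewrite inE ca in ac.
    by rewrite (negbTE ac).
  by rewrite -!fE flo.
by move=> le_k E; apply/idP/idP; apply: half.
Qed.

End Codes.

(** * Orders realizing prescribed codes many times *)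

Section RichOrders.

Variables (sigma : vocabulary) (A : fin_structure sigma) (d r s : nat).
Hypothesis dA : bounded_degree d A.

(** Greedy placement: each requested code gets a new centre far from [S] and from earlier centres,
    and the order is changed only on the [r]-ball of that centre. [X] collects all centres, [G o]
    those chosen for [o]. *)
Lemma place_codes (S : {set A}) (lo0 : A -> rel A) (os : seq (code sigma d r)) :
  local_order lo0 ->
  (forall o, o \in os -> #|S| * d.+1 ^ (r + s) + size os * d.+1 ^ (r + r)
                         < #|code_set A o|) ->
  exists2 lo : A -> rel A,
    local_order lo /\ forall x, x \in ball s S -> lo x =2 lo0 x
  & exists (X : {set A}) (G : code sigma d r -> {set A}),
    [/\ #|X| <= size os, forall o, G o \subset X,
        forall o, #|G o| = count_mem o os
      & forall o c, c \in G o -> realizes lo c o /\ c \notin ball (r + s) S].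
Proof.
move=> lo0_lo; elim: os => [|o os IH] big_o.
  exists lo0 => //; exists set0, (fun=> set0).
  split=> [|o|o|o c]; rewrite ?cards0 ?sub0set ?inE //.
have [o' o'_os|lo [lo_lo loE] [X [G [leX subG cardG GP]]]] := IH.
  apply: leq_ltn_trans (big_o o' _); last by rewrite inE o'_os orbT.
  by rewrite leq_add2l leq_mul2r leqnSn orbT.
(* The two terms of the hypothesis bound the points too close to [S] and those whose [r]-ball could
   meet that of an earlier centre. *)
have [c cC cF] : exists2 c, c \in code_set A o &
    c \notin ball (r + s) S :|: ball (r + r) X.
  apply/subsetPn; apply: contraL (big_o o (mem_head _ _)) => /subset_leq_card leC.
  rewrite -leqNgt (leq_trans leC) // (leq_trans (leq_card_setU _ _)) //.
  rewrite leq_add ?card_ball // (leq_trans (card_ball _ _ dA)) //.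
  by rewrite leq_mul2r (leq_trans leX) ?orbT //= leqnSn.
move: cF; rewrite !inE negb_or => /andP[cS cX].
move: cC; rewrite inE => /asboolP[lo1 lo1_lo c_o].
pose lo2 x := if x \in ball r [set c] then lo1 x else lo x.
have farX x : x \in ball r X -> x \notin ball r [set c].
  by move=> Xx; apply: contra cX => /ball_back/(_ Xx).
exists lo2; first split.
- exact: (local_order_patch (fun x => x \in ball r [set c])).
- move=> x Sx; rewrite /lo2 ifN; first exact: loE.
  by apply: contra cS => /ball_back/(_ Sx).
exists (c |: X), (fun o' => if o' == o then c |: G o' else G o'); split.
- by rewrite cardsU1 /= -add1n leq_add // leq_b1.
- move=> o'; case: ifP => _; first exact: setUS.
  by rewrite (subset_trans (subG o')) // subsetUr.
- move=> o'; rewrite /= eq_sym; case: eqP => _; rewrite ?add0n // cardsU1 cardG.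
  have /negbTE-> // : c \notin G o'.
  apply: contra cX => /(subsetP (subG o')); apply: (subsetP (ball_id _ _)).
- move=> o' c' c'_G; have [|] := boolP (c' \in G o').
    move=> /[dup] c'G /GP[c'_o' ?]; split=> //.
    apply: realizes_agree c'_o' => x c'x y z; rewrite /lo2 ifN // farX //.
    apply: subsetP c'x; apply: ball_mono => //.
    by rewrite sub1set (subsetP (subG o')).
  move: c'_G; case: eqP => [->|_ ->//]; rewrite !inE => /orP[/eqP->|->//] _.
  by split=> //; apply: realizes_agree c_o => x cx y z; rewrite /lo2 cx.
Qed.

Definition rich m (S : {set A}) (Omega : {set code sigma d r})
    (lo : A -> rel A) : Prop :=
  forall o, o \notin Omega -> forall W : {set A}, #|W| <= m ->
  exists2 c, c \notin ball s (S :|: W) & realizes lo c o.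

(** One more than the number of centres that [m] pebbles can spoil within distance [s]. *)
Definition copies m := (m * d.+1 ^ s).+1.

(** The bound in [place_codes] for a set of size [n] and [copies m] requests per code. *)
Definition rich_bound m n :=
  n * d.+1 ^ (r + s) + #|code sigma d r| * copies m * d.+1 ^ (r + r).

Lemma rich_order_exists m (S : {set A}) (Omega : {set code sigma d r}) lo0 :
  local_order lo0 ->
  (forall o, o \notin Omega -> rich_bound m #|S| < #|code_set A o|) ->
  exists lo : A -> rel A, [/\ local_order lo,
    forall x, x \in ball s S -> lo x =2 lo0 x & rich m S Omega lo].
Proof.
move=> lo0_lo big_o.
pose os := flatten [seq nseq (copies m) o | o <- enum (~: Omega)].
have size_os : size os <= #|code sigma d r| * copies m.
  rewrite size_flatten /shape -map_comp (eq_map (g := fun=> copies m)); last first.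
    by move=> o /=; rewrite size_nseq.
  by rewrite sumnE big_map big_enum sum_nat_const leq_mul2r max_card orbT.
have [o|lo [lo_lo loE] [X [G [_ _ cardG GP]]]] := place_codes (S := S) (os := os) lo0_lo.
  case/flattenP=> _ /mapP[o1 o1_O ->]; rewrite mem_nseq => /andP[_ /eqP->].
  rewrite mem_enum inE in o1_O; apply: leq_ltn_trans (big_o _ o1_O).
  by rewrite leq_add2l leq_mul2r size_os orbT.
exists lo; split=> // o oO W leW.
have leG : copies m <= #|G o|.
  rewrite cardG count_flatten -map_comp sumnE big_map big_enum /=.
  by rewrite (bigD1 o) ?inE //= count_nseq /= eqxx mul1n leq_addr.
(* There are more centres for [o] than points in the [s]-ball of [W]. *)
have [c cG cW] : exists2 c, c \in G o & c \notin ball s W.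
  apply/subsetPn; apply: contraL leG => /subset_leq_card leG.
  rewrite -ltnNge /copies ltnS (leq_trans leG) // (leq_trans (card_ball _ _ dA)) //.
  by rewrite leq_mul2r leW orbT.
have [c_o cS] := GP _ _ cG; exists c => //.
rewrite ballU inE negb_or cW andbT; apply: contra cS; apply: ballW.
exact: leq_addl.
Qed.

End RichOrders.

(** * Duplicator's strategy on the ordered expansions *)

Section Game.

Variable sigma : vocabulary.
Implicit Types A B C : fin_structure sigma.

(** On both sides the [r.+1]-balls around the point and the set are disjoint and the [r]-balls are
    not adjacent, so no relation holds across them and the two maps can be joined. *)
Lemma local_iso_glue A B r (P : {set A}) (f g : A -> B) loA loB a b :
  local_iso r P f -> local_order_iso r P f loA loB ->
  local_iso r [set a] g -> local_order_iso r [set a] g loA loB -> g a = b ->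
  a \notin ball (r + r).+3 P -> b \notin ball (r + r).+3 (f @: P) ->
  exists h : A -> B, [/\ local_iso r (a |: P) h,
    local_order_iso r (a |: P) h loA loB, {in P, h =1 f} & h a = b].
Proof.
move=> fiso flo giso glo ga aP bP.
have far C (c : C) (Q : {set C}) x y : c \notin ball (r + r).+3 Q ->
    x \in ball r.+1 Q -> y \in ball r.+1 [set c] -> x != y.
  move=> cQ Qx cy; apply: contraNneq cQ => xy; rewrite -xy in cy.
  by apply: ballW (ball_back cy Qx); rewrite addSn addnS.
have nonadj C (c : C) (Q : {set C}) x y : c \notin ball (r + r).+3 Q ->
    x \in ball r Q -> y \in ball r [set c] -> ~~ gaifman x y.
  move=> cQ Qx cy; apply/negP => /(ball_neighbor Qx) Qy.
  by have := far _ _ _ _ _ cQ Qy (ballW (leqnSn r) cy); rewrite eqxx.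
have not_rel C (c : C) (Q : {set C}) s (t : (arity s).-tuple C) x y :
    c \notin ball (r + r).+3 Q -> x \in t -> y \in t ->
    x \in ball r Q -> y \in ball r [set c] -> interp t = false.
  move=> cQ tx ty Qx cy; apply/negP => tI.
  have := nonadj _ _ _ _ _ cQ Qx cy; rewrite /gaifman.
  rewrite (far _ _ _ _ _ cQ (ballW (leqnSn r) Qx) (ballW (leqnSn r) cy)) /=.
  by case/existsP; exists s; apply/existsP; exists t; rewrite tI tx ty.
have ballf s x : s <= r.+1 -> x \in ball s P -> f x \in ball s (f @: P).
  by move=> le_s Px; rewrite -(local_iso_ball fiso) // imset_f.
have ballg s x : s <= r.+1 -> x \in ball s [set a] -> g x \in ball s [set b].
  by move=> le_s Px; rewrite -ga -imset_set1 -(local_iso_ball giso) // imset_f.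
pose h x := if x \in ball r.+1 [set a] then g x else f x.
have hf x : x \in ball r.+1 P -> h x = f x.
  move=> Px; rewrite /h; case: ifP => // ax.
  by have := far _ _ _ _ _ aP Px ax; rewrite eqxx.
have hg x : x \in ball r.+1 [set a] -> h x = g x by rewrite /h => ->.
have hfg x y : x \in ball r.+1 P -> y \in ball r.+1 [set a] -> h x != h y.
  by move=> Px ay; rewrite hf // hg // (far _ _ _ _ _ bP) ?ballf ?ballg.
have nbrW s (Q : {set A}) x y : x \in ball s Q -> y \in neighbors x -> y \in ball s.+1 Q.
  by move=> Qx; rewrite inE; apply: ball_neighbor.
have [[f_inj f_rel f_nbr] [g_inj g_rel g_nbr]] := (fiso, giso).
exists h; split; first split.
- move=> x y; rewrite !ballU => /setUP[ax|Px] /setUP[ay|Py] E.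
  + by rewrite !hg // in E; apply: g_inj.
  + by have := hfg _ _ Py ax; rewrite E eqxx.
  + by have := hfg _ _ Px ay; rewrite E eqxx.
  + by rewrite !hf // in E; apply: f_inj.
- move=> s t tPa.
  have tPaP x : x \in t -> x \in ball r [set a] \/ x \in ball r P.
    by move/tPa; rewrite ballU inE => /orP.
  have [/allP tP|/allPn[y ty yP]] := boolP (all (mem (ball r P)) t).
    rewrite -f_rel //; congr interp; apply: eq_from_tnth => i.
    rewrite !tnth_map hf //; apply: (ballW (leqnSn r)); apply: tP.
    exact: mem_tnth.
  have {yP} ay : y \in ball r [set a] by case: (tPaP y ty) => // /(negP yP).
  have [/allP ta|/allPn[x tx xa]] := boolP (all (mem (ball r [set a])) t).
    rewrite -g_rel //; congr interp; apply: eq_from_tnth => i.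
    rewrite !tnth_map hg //; apply: (ballW (leqnSn r)); apply: ta.
    exact: mem_tnth.
  (* The tuple meets both balls, so neither it nor its image satisfies the relation. *)
  have {xa} Px : x \in ball r P by case: (tPaP x tx) => // /(negP xa).
  rewrite (not_rel _ _ _ _ _ _ _ aP tx ty) //.
  apply: (not_rel _ _ _ _ _ (h x) (h y) bP).
  + exact: map_f.
  + exact: map_f.
  + by rewrite hf ?ballf ?(ballW _ Px).
  + by rewrite hg ?ballg ?(ballW _ ay).
- move=> x; rewrite ballU inE => /orP[ax|Px].
    rewrite hg ?(ballW _ ax) // -g_nbr //; apply: eq_in_imset => y /(nbrW _ _ _ _ ax).
    exact: hg.
  rewrite hf ?(ballW _ Px) // -f_nbr //; apply: eq_in_imset => y /(nbrW _ _ _ _ Px).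
  exact: hf.
- move=> x y z; rewrite ballU inE => /orP[ax|Px] xy xz.
    by rewrite (hg x) ?(ballW _ ax) // !hg ?(nbrW _ _ _ _ ax xy) ?(nbrW _ _ _ _ ax xz) ?glo.
  by rewrite (hf x) ?(ballW _ Px) // !hf ?(nbrW _ _ _ _ Px xy) ?(nbrW _ _ _ _ Px xz) ?flo.
- by move=> x Px; rewrite hf // (subsetP (ball_id _ _)).
- by rewrite hg // ball_center.
Qed.

Lemma local_iso_atp A B r (P : {set A}) (f : A -> B) loA loB n
    (v : n.-tuple (expansion loA)) (w : n.-tuple (expansion loB)) :
  local_order loA -> local_order loB ->
  local_iso r P f -> local_order_iso r P f loA loB ->
  (forall i, tnth v i \in P) -> (forall i, tnth w i = f (tnth v i)) ->
  atp v = atp w.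
Proof.
move=> loA_lo loB_lo fiso flo vP wE.
have Pb s x : x \in P -> x \in ball s P by apply: subsetP; exact: ball_id.
apply/ffunP; case=> [[i j]|[[s|] t]]; rewrite !ffunE /=.
- rewrite !wE; have [f_inj _ _] := fiso.
  by apply/eqP/eqP => [->//|/f_inj->]; rewrite ?Pb.
- have [_ f_rel _] := fiso.
  rewrite -f_rel; last by move=> x /mapP[i _ ->]; apply: Pb.
  congr interp; apply: eq_from_tnth => i.
  by rewrite !tnth_map wE.
- rewrite !tnth_map !wE; symmetry.
  by apply: (local_iso_lo fiso flo loA_lo loB_lo); rewrite Pb.
Qed.

(* With [q] the radius needed after a move, pebbles at distance more than
   [2 * q + 3] have [q.+1]-balls that are neither adjacent nor overlapping; a
   closer one must have its [q]-ball inside the current local isomorphism. *)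
Fixpoint game_radius j :=
  if j is j'.+1 then game_radius j' + (game_radius j' + game_radius j').+3 else 0.

Lemma game_radius_mono j k : j <= k -> game_radius j <= game_radius k.
Proof.
move=> /subnK<-; elim: (k - j) => //= i IH; apply: leq_trans IH _.
exact: leq_addr.
Qed.

Section Duplicator.

Variables (A B : fin_structure sigma) (d m : nat).
Let r := game_radius m.
Let s := (r + r).+3.
Variables (loA : A -> rel A) (loB : B -> rel B) (SA : {set A}) (SB : {set B}).
Variable Omega : {set code sigma d r}.
Hypotheses (dA : bounded_degree d A) (dB : bounded_degree d B).
Hypotheses (loA_lo : local_order loA) (loB_lo : local_order loB).
Hypothesis rareA : forall a o, a \in code_set A o -> o \in Omega -> a \in SA.
Hypothesis rareB : forall b o, b \in code_set B o -> o \in Omega -> b \in SB.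
Hypotheses (richA : rich s m SA Omega loA) (richB : rich s m SB Omega loB).

(** Induction on the rounds left. The radius of the invariant shrinks with [j], and [n + j <= m]
    keeps the number of pebbles within the range of [rich]. *)
Lemma tp_expansion_game j n (v : n.-tuple (expansion loA))
    (w : n.-tuple (expansion loB)) (f : A -> B) :
  n + j <= m ->
  local_iso (game_radius j) (SA :|: [set x : A | x \in v]) f ->
  local_order_iso (game_radius j) (SA :|: [set x : A | x \in v]) f loA loB ->
  f @: SA = SB -> w = [tuple of map f v] -> tp j v = tp j w.
Proof.
elim: j n v w f => [|j IH] n v w f le_nj fiso flo fS wE.
  apply: (local_iso_atp loA_lo loB_lo fiso flo) => i.
    by rewrite !inE mem_tnth orbT.
  by rewrite wE tnth_map.
set V := [set x : A | x \in v] in fiso flo *; set P := SA :|: V in fiso flo *.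
pose W := [set y : B | y \in w].
have fP : f @: P = SB :|: W.
  rewrite imsetU fS; congr (_ :|: _); apply/setP => y; rewrite inE wE.
  apply/imsetP/mapP => [[x]|[x xv ->]]; last by exists x; rewrite ?inE.
  by rewrite inE => xv ->; exists x.
have leW : #|W| <= m.
  rewrite cardsE (leq_trans (card_size w)) // size_tuple.
  by apply: leq_trans le_nj; apply: leq_addr.
have leV : #|V| <= m.
  rewrite cardsE (leq_trans (card_size v)) // size_tuple.
  by apply: leq_trans le_nj; apply: leq_addr.
set q := game_radius j.
have le_qr : q <= r.
  by apply: game_radius_mono; apply: leq_trans le_nj; rewrite addnS ltnW // ltnS leq_addl.
have le_qs : (q + q).+3 <= s by rewrite !ltnS leq_add.
have setP_cons x : SA :|: [set y : A | y \in [tuple of x :: v]] = x |: P.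
  by apply/setP => y; rewrite !inE; case: (y == x); rewrite ?orbT.
have le_q : q <= game_radius j.+1 by apply: leq_addr.
pose tpA := @tp _ (expansion loA) j n.+1; pose tpB := @tp _ (expansion loB) j n.+1.
have step x h : local_iso q (x |: P) h -> local_order_iso q (x |: P) h loA loB ->
    {in P, h =1 f} -> tpA [tuple of x :: v] = tpB [tuple of h x :: w].
  move=> hiso hlo hE; apply: (IH _ _ _ h).
  - by rewrite addSnnS.
  - by rewrite setP_cons.
  - by rewrite setP_cons.
  - by rewrite -fS; apply: eq_in_imset => y Sy; rewrite hE // inE Sy.
  - apply: val_inj; rewrite /= wE; congr (_ :: _); apply/eq_in_map => y yv.
    by rewrite hE // !inE yv orbT.
(* The [q]-ball of such an [x] lies within [game_radius j.+1] of [P], so [f] itself answers. *)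
have close x : x \in ball (q + q).+3 P ->
    tpA [tuple of x :: v] = tpB [tuple of f x :: w].
  move=> Px; have sub : x |: P \subset ball (q + q).+3 P.
    by rewrite subUset sub1set Px ball_id.
  have sub_q k : ball (k + q) (x |: P) \subset ball (k + game_radius j.+1) P.
    by rewrite [game_radius _]/= addnA -/q -[ball _ P]ball_ball ball_mono.
  apply: step => //; first exact: local_iso_sub (sub_q 0) (sub_q 1) fiso.
  exact: local_order_iso_sub (sub_q 0) flo.
(* A common code gives an isomorphism of radius [r], at least [q], which is glued to the restriction
   of [f] to radius [q]. *)
have far x y : x \notin ball (q + q).+3 P -> y \notin ball (q + q).+3 (SB :|: W) ->
    forall o : code sigma d r, realizes loA x o -> realizes loB y o ->
    tpA [tuple of x :: v] = tpB [tuple of y :: w].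
  move=> xP yP o xo yo; have [g [giso glo gx]] := realizes_iso xo yo.
  have sub_q k : ball (k + q) P \subset ball (k + game_radius j.+1) P.
    by apply: ball_mono; rewrite ?leq_add2l.
  have sub_r k : ball (k + q) [set x] \subset ball (k + r) [set x].
    by apply: ball_mono; rewrite ?leq_add2l.
  rewrite -fP in yP.
  have [h [hiso hlo hf hx]] := local_iso_glue
    (local_iso_sub (sub_q 0) (sub_q 1) fiso) (local_order_iso_sub (sub_q 0) flo)
    (local_iso_sub (sub_r 0) (sub_r 1) giso) (local_order_iso_sub (sub_r 0) glo)
    gx xP yP.
  by rewrite (step x h) // hx.
apply: tpS_intro.
- apply: (local_iso_atp loA_lo loB_lo fiso flo) => i.
    by rewrite !inE mem_tnth orbT.
  by rewrite wE tnth_map.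
- move=> x; have [Px|xP] := boolP (x \in ball (q + q).+3 P).
    by exists (f x); apply: close.
  have [o xo] := realizes_exists r loA x dA.
  (* [loA] itself shows that [x] admits [o], so a code in [Omega] would put [x] in [SA]. *)
  have oO : o \notin Omega.
    apply: contra xP => /rareA Sx; apply: (subsetP (ball_id _ _)).
    by rewrite inE Sx // inE; apply/asboolP; exists loA.
  have [y yW yo] := richB oO leW; exists y; apply: (far _ _ xP _ o) => //.
  by apply: contra yW; apply: ballW.
- move=> y; have [|yP] := boolP (y \in ball (q + q).+3 (SB :|: W)).
    (* [f] maps balls onto balls, so a close [y] has a close preimage. *)
    rewrite -fP -(local_iso_ball fiso); last first.
      by rewrite /= -/q ltnW // ltnS leq_addl.
    by case/imsetP=> x Px ->; exists x; apply: close.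
  have [o yo] := realizes_exists r loB y dB.
  have oO : o \notin Omega.
    apply: contra yP => /rareB Sy; apply: (subsetP (ball_id _ _)).
    by rewrite inE Sy // inE; apply/asboolP; exists loB.
  have [x xV xo] := richA oO leV; exists x; apply: (far _ _ _ yP o) => //.
  by apply: contra xV; apply: ballW.
Qed.

End Duplicator.

End Game.

(** Otherwise each of [#|I|.+1] disjoint intervals between consecutive iterates of [g] contains some
    [c i], against the pigeonhole principle. *)
Lemma threshold_gap (I : finType) (c : I -> nat) (g : nat -> nat) :
  (forall t, t <= g t) ->
  exists k : 'I_#|I|.+1,
    forall i, (c i <= iter k g 0) || (g (iter k g 0) < c i).
Proof.
move=> le_g.
have iter_mono k l : k <= l -> iter k g 0 <= iter l g 0.
  move=> /subnK<-; elim: (l - k) => //= i IH; exact: leq_trans IH (le_g _).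
case: (boolP [exists k : 'I_#|I|.+1,
    forall i, (c i <= iter k g 0) || (g (iter k g 0) < c i)]).
  by case/existsP=> k /forallP; exists k.
rewrite negb_exists => /forallP no_k.
have /fin_all_exists[F FP] (k : 'I_#|I|.+1) :
    exists i, iter k g 0 < c i <= iter k.+1 g 0.
  have := no_k k; rewrite negb_forall => /existsP[i].
  by rewrite negb_or -ltnNge -leqNgt; exists i.
have F_lt (k l : 'I_#|I|.+1) : k < l -> F k != F l.
  move=> lt_kl; apply/eqP => E.
  have /andP[_ le_k] := FP k; have /andP[lt_l _] := FP l.
  have := leq_trans lt_l; rewrite -E => /(_ _ le_k).
  by rewrite ltnNge iter_mono.
have F_inj : injective F.
  move=> k l E; apply: val_inj; case: (ltngtP k l) => // /F_lt; rewrite E eqxx //.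
by have := leq_card F F_inj; rewrite card_ord ltnn.
Qed.

(** * Equivalent expansions from equal types *)

Section MainTheorem.

Variables (sigma : vocabulary) (d m : nat).
Implicit Types A B : fin_structure sigma.

Let r := game_radius m.
Let s := (r + r).+3.
Let code := code sigma d r.

(** The rank at which [tp_code_set] applies, plus one round. *)
Definition transfer_depth := (code_size d r + (r.+2 + max_arity sigma)).+1.

(** Copying [n] distinct elements takes [n] rounds, and the remaining rank preserves membership in
    [code_set]. *)
Lemma card_code_set_le A B n o :
  tp (n + transfer_depth) [tuple of [::] : seq A] =
    tp (n + transfer_depth) [tuple of [::] : seq B] ->
  n <= #|@code_set sigma d r A o| -> n <= #|@code_set sigma d r B o|.
Proof.
move=> E le_n; pose l := take n (enum (@code_set sigma d r A o)).
have size_l : size l == n by rewrite size_take_min -cardE; apply/eqP/minn_idPl.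
pose v := Tuple size_l; have [w Ew] := tp_forth E v.
have w_inj : injective (tnth w).
  have v_inj : injective (tnth v).
    by apply/tuple_uniqP; rewrite take_uniq ?enum_uniq.
  move=> i j /eqP; have := atp_eq (tpS_atp Ew) (lshift 0 i) (lshift 0 j).
  by rewrite !tnth_lshift => <- /eqP/v_inj.
rewrite -[n]card_ord -(card_imset _ w_inj); apply: subset_leq_card.
apply/subsetP => _ /imsetP[i _ ->].
have := tp_code_set (lshift 0 i) o (leqnSn _) Ew; rewrite !tnth_lshift => <-.
by rewrite -mem_enum (mem_take (mem_tnth i v)).
Qed.

Definition rare_set A (Omega : {set code}) : {set A} :=
  \bigcup_(o in Omega) code_set A o.

Lemma rare_set_iso A B n (v : n.-tuple A) (w : n.-tuple B) (Omega : {set code}) :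
  tp transfer_depth v = tp transfer_depth w ->
  (forall x, x \in ball r.+1 (rare_set A Omega) -> exists i, x = tnth v i) ->
  exists f : A -> B,
    local_iso r (rare_set A Omega) f /\ f @: rare_set A Omega = rare_set B Omega.
Proof.
move=> E covA; have E0 := tpS_atp E.
have rareE k l (p : l.-tuple A) (q : l.-tuple B) i :
    code_size d r + (r.+2 + max_arity sigma) <= k -> tp k p = tp k q ->
    (tnth p i \in rare_set A Omega) = (tnth q i \in rare_set B Omega).
  move=> le_k Ek.
  by apply/bigcupP/bigcupP => -[o oO io]; exists o;
    rewrite // ?(tp_code_set i o le_k Ek) // -(tp_code_set i o le_k Ek).
(* [enum_fun] needs a default map; if [B] is empty then so is [A], by the forth property. *)
have [f0 _] : exists f : A -> B, True.
  case: (pickP B) => [b _|noB]; first by exists (fun=> b).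
  have noA (x : A) : False.
    by have [y _] := tpS_forth E x; have := noB y.
  by exists (fun x => False_rect _ (noA x)).
have [f fE] := enum_fun f0 (atp_eq E0).
(* First the rare element [b] near [y] is answered in [A], which shows that it is an entry of [w];
   then [y] is answered, inside the ball covered by [v]. *)
have covB y : y \in ball r.+1 (rare_set B Omega) -> exists i, y = tnth w i.
  case/ball_point=> b bO yb.
  have [a Ea] := tpS_back E b.
  have := rareE _ _ _ _ ord0 (leqnn _) Ea; rewrite !tnth0 bO => aO.
  have [i ai] := covA a (subsetP (ball_id _ _) a aO).
  have := atp_eq (tpS_atp Ea) ord0 (lift ord0 i).
  rewrite !tnthS !tnth0 -ai eqxx => /esym/eqP bi.
  have [x Ex] := tpS_back E y.
  have le_k : r.+1 + max_arity sigma <= code_size d r + (r.+2 + max_arity sigma).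
    by rewrite addnCA leq_add // leq_addl.
  have := tp_ball ord0 (lift ord0 i) le_k Ex.
  rewrite !tnthS !tnth0 -ai -bi yb => xa.
  have [j xj] : exists j, x = tnth v j.
    apply: covA; apply: subsetP xa; apply: ball_mono => //.
    by rewrite sub1set.
  exists j; have := atp_eq (tpS_atp Ex) ord0 (lift ord0 j).
  by rewrite !tnthS !tnth0 -xj eqxx => /esym/eqP.
have [|||_ fiso fS] := local_iso_enum (atp_eq E0) _ _ _ covA covB fE.
- by move=> s' t; apply: atp_rel E0 _ _.
- move=> i j; apply: tp_gaifman E.
  by rewrite leqW // addnA leq_addl.
- by move=> i; apply: rareE E; apply: leqnSn.
by exists f.
Qed.

(** If each rare code has at most [t] elements, the rare set has at most [#|code| * t]; codes above
    this bound can be made rich. The summand [t] provides the monotonicity asked by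
    [threshold_gap]. *)
Definition rare_bound t :=
  t + rich_bound sigma d r s m (#|code| * t).

(** Enough rank to copy the [r.+1]-ball of the rare set, and also to count up to
    [(rare_bound t).+1]. *)
Definition rare_depth t :=
  #|code| * t * d.+1 ^ r.+1 + ((rare_bound t).+1 + transfer_depth).

Lemma expansions_tp_eq : exists k, forall A B,
  bounded_degree d A -> bounded_degree d B ->
  tp k [tuple of [::] : seq A] = tp k [tuple of [::] : seq B] ->
  exists (loA : A -> rel A) (loB : B -> rel B),
    [/\ local_order loA, local_order loB &
        tp m [tuple of [::] : seq (expansion loA)] =
        tp m [tuple of [::] : seq (expansion loB)]].
Proof.
(* The threshold depends on [A], so the rank is the maximum over the finitely many candidates. *)
exists (\max_(i < #|code|.+1) rare_depth (iter i rare_bound 0)) => A B dA dB E.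
have [i gap] := threshold_gap (fun o : code => #|code_set A o|)
  (fun t => leq_addr _ _ : t <= rare_bound t).
set t := iter i rare_bound 0 in gap.
have {}E : tp (rare_depth t) [tuple of [::] : seq A] =
           tp (rare_depth t) [tuple of [::] : seq B].
  apply: tp_le E; exact: (leq_bigmax (F := fun i : 'I_ _ => rare_depth (iter i _ 0))).
pose Omega := [set o : code | #|code_set A o| <= t].
pose SA := rare_set A Omega; pose SB := rare_set B Omega.
have leSA : #|SA| <= #|code| * t.
  apply: (@leq_trans (#|Omega| * t)); last by rewrite leq_mul2r max_card orbT.
  by apply: card_bigcup_le => o; rewrite inE.
pose v := enum_tuple (ball r.+1 SA).
have [w Ew] : exists w : #|ball r.+1 SA|.-tuple B,
    tp transfer_depth [tuple of v ++ [tuple of [::] : seq A]] =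
    tp transfer_depth [tuple of w ++ [tuple of [::] : seq B]].
  apply: tp_forth; apply: tp_le E.
  rewrite leq_add ?leq_addl // (leq_trans (card_ball _ _ dA)) //.
  by rewrite leq_mul2r leSA orbT.
have [|f [fiso fS]] := rare_set_iso (Omega := Omega) Ew.
  by move=> x Sx; apply/tnthP; rewrite mem_cat mem_enum Sx.
have bigA o : o \notin Omega -> rare_bound t < #|code_set A o|.
  by rewrite inE => oO; have := gap o; rewrite (negbTE oO).
have bigB o : o \notin Omega -> rare_bound t < #|code_set B o|.
  move=> /bigA; apply: card_code_set_le; apply: tp_le E; exact: leq_addl.
have le_rich n : n <= #|code| * t -> rich_bound sigma d r s m n <= rare_bound t.
  move=> le_n; apply: leq_trans (leq_addl _ _).
  by rewrite leq_add2r leq_mul2r le_n orbT.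
(* [SB] is the image of [SA], so codes in [B] need not be counted from above. *)
have leSB : #|SB| <= #|code| * t.
  by rewrite /SB -fS (leq_trans (leq_imset_card _ _)).
(* [A] is enriched first; its order is carried to [B] near [SB], and [B] is then enriched away from
   [SB]. *)
have [lo0 lo0_lo] := local_order_exists A.
have [|loA [loA_lo _ richA]] :=
  rich_order_exists (s := s) (m := m) (S := SA) (Omega := Omega) dA lo0_lo.
  by move=> o /bigA; apply: leq_ltn_trans; apply: le_rich.
have [lo1 lo1_lo flo1] := local_order_transport fiso loA_lo.
have [|loB [loB_lo loBE richB]] :=
  rich_order_exists (s := s) (m := m) (S := SB) (Omega := Omega) dB lo1_lo.
  by move=> o /bigB; apply: leq_ltn_trans; apply: le_rich.
have PE : SA :|: [set x : A | x \in [tuple of [::] : seq (expansion loA)]] = SA.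
  by apply/setP => x; rewrite !inE orbF.
exists loA, loB; split=> //.
apply: (tp_expansion_game (f := f) dA dB loA_lo loB_lo _ _ richA richB);
  rewrite ?PE //.
- by move=> a o ao oO; apply/bigcupP; exists o.
- by move=> b o bo oO; apply/bigcupP; exists o.
- move=> x y z Sx xy xz; rewrite loBE ?flo1 //.
  apply: (@ballW _ _ r); first by rewrite ltnW // ltnS ltnW // ltnS ltnW // ltnS leq_addl.
  by rewrite /SB -fS -(local_iso_ball fiso) ?imset_f // leqnSn.
- exact: val_inj.
Qed.

End MainTheorem.

Theorem theorem3p6 (sigma : vocabulary) (d : nat) (J : struct_class sigma)
    (J_sub : forall A, J A -> @bounded_degree sigma d A)
    (J_elem : O_invariant_elementary (@bounded_degree sigma d) J) :
  fo_definable (@bounded_degree sigma d) J.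
Proof.
have [phi inv_phi J_phi] := J_elem.
have [k tp_k] := expansions_tp_eq sigma d (rank phi).
apply: (fo_definable_of_tp (k := k)) => A B dA dB E /(J_phi _ dA)[lo lo_lo lo_phi].
have [loA [loB [loA_lo loB_lo E']]] := tp_k _ _ dA dB E.
apply/(J_phi _ dB); exists loB => //.
(* Invariance replaces the given order [lo] by [loA], from which [phi] passes to [loB]. *)
have [all_phi|no_phi] := inv_phi _ dA; last first.
  by have := no_phi _ lo_lo; rewrite lo_phi.
have := all_phi _ loA_lo; rewrite /models.
by rewrite -(sat_tp (leqnn _) E').
Qed.
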